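(* Let $(X_1,\mathcal A_1)$ and $(X_2,\mathcal A_2)$ be standard Borel spaces and let $\rho$ be a ($\sigma$-finite Borel) measure on the product space $(X_1\times X_2,\mathcal A_1\times\mathcal A_2)$. Then a pair of measures $(\nu_1,\nu_2)$ defined on $X_1$ and $X_2$, respectively, is in $F(\rho)$ if and only if $$\rho\circ\pi_1^{-1}\ll\nu_1,\qquad \rho\circ\pi_2^{-1}\ll\nu_2 .$$
   Context: $\pi_i:X_1\times X_2\to X_i$ is the natural projection. Measures $\nu_i$ are Borel positive $\sigma$-finite measures on $(X_i,\mathcal A_i)$. A map $R:X\times\mathcal A'\to[0,\infty)$ (with $(X,\mathcal A)$, $(X',\mathcal A')$ standard Borel) is a transition kernel if $x\mapsto R(x,C)$ is Borel for every $C\in\mathcal A'$ and $C\mapsto R(x,C)$ is a $\sigma$-finite Borel measure for every $x\in X$; it is called finite if $R(x,\cdot)$ is a finite measure for every $x$, i.e. $0<R(x,X')<\infty$. $F(\rho)$ is the set of pairs $(\nu_1,\nu_2)$ for which there are finite transition kernels $P:X_1\times\mathcal A_2\to[0,\infty)$ and $Q:X_2\times\mathcal A_1\to[0,\infty)$ such that $d\rho(x,y)=d\nu_1(x)P(x,dy)=d\nu_2(y)Q(y,dx)$, i.e. $\rho(A\times B)=\int_AP(x,B)\,d\nu_1(x)=\int_BQ(y,A)\,d\nu_2(y)$ for all $A\in\mathcal A_1,B\in\mathcal A_2$.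
   Formalization: Finite kernels need only R(x,X')<∞; the condition 0<R(x,X') is dropped, since with it the ''if'' part fails when ν_i charges a set null for the marginal. The marginals of ρ are assumed σ-finite: otherwise F(ρ) is empty while dominating ν_i exist (e.g. Lebesgue measure on R²). *)

(* Defs.v *)
From HB Require Import structures.
From mathcomp Require Import all_boot all_order all_algebra.
From mathcomp Require Import all_classical all_reals all_analysis.

Set Implicit Arguments.
Unset Strict Implicit.
Unset Printing Implicit Defensive.

Import Order.TTheory GRing.Theory Num.Theory.
Import numFieldNormedType.Exports.

Local Open Scope classical_set_scope.
Local Open Scope ring_scope.
Local Open Scope ereal_scope.

(* A measurable space is standard Borel when it is isomorphic to a Polish space
   with its Borel sigma-algebra. The Hausdorff condition turns the library's
   pseudometric into a metric. *)
Definition standard_borel (R : realType) (d : measure_display)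
    (T : measurableType d) : Prop :=
  exists (X : completePseudoMetricType R) (f : T -> X),
    [/\ hausdorff_space X,
        exists2 S : set X, countable S & dense S,
        bijective f &
        forall A : set T, measurable A <-> <<s [set U : set X | open U] >> (f @` A)].

(* [R.-ftker X ~> Y] is the type of kernels with [k x setT < +oo] for each x;
   [R.-fker X ~> Y] would wrongly require a bound uniform in x. The mass
   [k x setT] is allowed to vanish: if it had to be positive for every x, then
   nu.1 would have to be absolutely continuous with respect to the marginal of
   rho, which fails in general (for instance when rho = 0 and nu.1 <> 0). *)
Definition F (R : realType) (d1 d2 : measure_display)
    (X1 : measurableType d1) (X2 : measurableType d2)
    (rho : {sigma_finite_measure set (X1 * X2)%type -> \bar R}) :
    set ({sigma_finite_measure set X1 -> \bar R} *
         {sigma_finite_measure set X2 -> \bar R}) :=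
  [set nu : {sigma_finite_measure set X1 -> \bar R} *
            {sigma_finite_measure set X2 -> \bar R} |
    exists (P : R.-ftker X1 ~> X2) (Q : R.-ftker X2 ~> X1),
      forall (A : set X1) (B : set X2), measurable A -> measurable B ->
        rho (A `*` B) = \int[nu.1]_(x in A) P x B /\
        rho (A `*` B) = \int[nu.2]_(y in B) Q y A].

(* Main.v *)
(* The direct implication is immediate. For the converse, one disintegrates rho
   along its first marginal relatively to nu1, and swaps the factors to get Q.

   A standard Borel space X2 embeds in nat -> bool with a measurable left
   inverse e: the bits of a point y record which balls around a dense sequence
   contain y, and e takes the limit of the centres so designated. For every
   finite word w, let f w be the Radon-Nikodym derivative w.r.t. nu1 of
   A |-> rho (A x {y | the code of y extends w}); for nu1-almost every x,
   f w x = f w0 x + f w1 x for all w, so the interval [0, f nil x[ is cut in a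
   dyadic tree of subintervals of lengths f w x. Reading off the branch of the
   tree above u gives a jointly measurable D(x, u) in nat -> bool, and
   P(x, B) = lebesgue {u in [0, f nil x[ | e (D(x, u)) in B} is the desired
   kernel: it has the right values on cylinders, which form a pi-system. *)
Require Import Defs.
From HB Require Import structures.
From mathcomp Require Import all_boot all_order all_algebra.
From mathcomp Require Import all_classical all_reals all_analysis.
From mathcomp Require Import measurable_realfun lra.

Set Implicit Arguments.
Unset Strict Implicit.
Unset Printing Implicit Defensive.

Import Order.TTheory GRing.Theory Num.Theory.

Local Open Scope classical_set_scope.
Local Open Scope ring_scope.
Local Open Scope ereal_scope.

(** * Kernels built from the sections of a fixed measure *)

Section kernel_of_sections.
Context d1 d2 dZ (X : measurableType d1) (Y : measurableType d2)
  (Z : measurableType dZ) (R : realType).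
Variables (m : {sigma_finite_measure set Z -> \bar R}) (T : X * Z -> Y).
Hypothesis mT : measurable_fun setT T.

Definition section_ker (D : set (X * Z)) (mD : measurable D) (x : X)
    (B : set Y) : \bar R := m (xsection (D `&` T @^-1` B) x).

Section measure.
Variables (D : set (X * Z)) (mD : measurable D).

Let measurable_DT (B : set Y) : measurable B -> measurable (D `&` T @^-1` B).
Proof.
by move=> mB; apply: measurableI => //; rewrite -[_ @^-1` _]setTI; exact: mT.
Qed.

Let section_ker0 x : section_ker mD x set0 = 0.
Proof. by rewrite /section_ker preimage_set0 setI0 xsection0 measure0. Qed.

Let section_ker_ge0 x B : 0 <= section_ker mD x B.
Proof. exact: measure_ge0. Qed.

Let section_ker_sigma_additive x : semi_sigma_additive (section_ker mD x).
Proof.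
move=> F mF tF mUF; rewrite /section_ker preimage_bigcup setI_bigcupr.
rewrite xsection_bigcup; apply: measure_semi_sigma_additive.
- by move=> n; apply: measurable_xsection; exact: measurable_DT.
- apply: trivIset_xsection; apply/trivIsetP => i j _ _ ij.
  rewrite setIACA setIid -preimage_setI.
  move/trivIsetP : tF => /(_ i j Logic.I Logic.I ij) ->.
  by rewrite preimage_set0 setI0.
- rewrite -xsection_bigcup -setI_bigcupr -preimage_bigcup.
  by apply: measurable_xsection; exact: measurable_DT.
Qed.

HB.instance Definition _ x := isMeasure.Build _ _ _ (section_ker mD x)
  (section_ker0 x) (section_ker_ge0 x) (@section_ker_sigma_additive x).

Let measurable_section_ker B : measurable B ->
  measurable_fun setT (section_ker mD ^~ B).
Proof.
by move=> mB; apply: (measurable_fun_xsection m); exact: measurable_DT.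
Qed.

Definition section_kernel (x : X) : {measure set Y -> \bar R} :=
  section_ker mD x.

HB.instance Definition _ :=
  isKernel.Build _ _ _ _ _ section_kernel measurable_section_ker.

End measure.

Variables (D : set (X * Z)) (mD : measurable D).

(** Restricting [m] to the pieces of a partition of [Z] into sets of finite measure yields kernels
    whose masses are bounded uniformly in [x]. *)
Lemma section_ker_sfinite : exists2 s : (R.-ker X ~> Y)^nat,
    forall n, measure_fam_uub (s n) &
    forall x U, measurable U -> section_kernel mD x U = kseries s x U.
Proof.
have [F TF /all_and2[mF muFoo]] := sigma_finiteT m.
pose E := seqDU F.
have mE k : measurable (E k).
  by apply: measurableD => //; exact: bigsetU_measurable.
have UET : \bigcup_i E i = [set: Z] by rewrite TF [RHS]seqDU_bigcup_eq.
have mDE n : measurable (D `&` setT `*` E n).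
  by apply: measurableI => //; exact: measurableX.
exists (fun n => section_kernel (mDE n)).
  (* The required bound is strict, hence the added 1. *)
  move=> n; exists (fine (m (E n)) + 1)%R => x.
  have mEoo : m (E n) < +oo.
    by rewrite (le_lt_trans _ (muFoo n))// le_measure ?inE//; exact: subDsetl.
  rewrite EFinD fineK ?ge0_fin_numE//.
  apply: (@le_lt_trans _ _ (m (E n))); last by rewrite lteDl ?ge0_fin_numE.
  apply: le_measure; rewrite ?inE//.
    by apply: measurable_xsection; rewrite preimage_setT setIT.
  by move=> z /xsectionP[[_ []]].
move=> x U mU; rewrite /kseries/= /mseries/=.
have mDU : measurable (D `&` T @^-1` U).
  by apply: measurableI => //; rewrite -[_ @^-1` _]setTI; exact: mT.
rewrite -[LHS]/(m (xsection _ x)).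
have -> : xsection (D `&` T @^-1` U) x =
    \bigcup_n xsection ((D `&` setT `*` E n) `&` T @^-1` U) x.
  rewrite -xsection_bigcup; congr (xsection _ x); apply/seteqP; split.
    move=> [y z] [Dyz Tyz]; have : setT z by [].
    by rewrite -UET => -[n _ Enz]; exists n.
  by move=> [y z] [n _ [[Dyz _] Tyz]].
rewrite measure_bigcup //=.
- by apply: eq_eseriesl => n; rewrite in_setT.
- move=> n _; apply: measurable_xsection; apply: measurableI => //.
  by rewrite -[_ @^-1` _]setTI; exact: mT.
- apply/trivIsetP => i j _ _ ij.
  have /trivIsetP /(_ i j Logic.I Logic.I ij) := trivIset_seqDU F.
  rewrite -!subset0 => Eij z [] /xsectionP[[_ [_ iz]] _].
  move=> /xsectionP[[_ [_ jz]] _].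
  exact: (Eij z).
Qed.

HB.instance Definition _ :=
  isSFiniteKernel_subdef.Build _ _ _ _ _ (section_kernel mD)
    section_ker_sfinite.

Hypothesis Doo : forall x, m (xsection D x) < +oo.

Let section_ker_finite x : fin_num_fun (section_kernel mD x).
Proof.
move=> B mB; rewrite ge0_fin_numE//; apply: le_lt_trans (Doo x).
apply: le_measure; rewrite ?inE.
- apply: measurable_xsection; apply: measurableI => //.
  by rewrite -[_ @^-1` _]setTI; exact: mT.
- exact: measurable_xsection.
- by move=> z /xsectionP[? _]; exact/xsectionP.
Qed.

HB.instance Definition _ :=
  isFiniteTransitionKernel.Build _ _ _ _ _ (section_kernel mD)
    section_ker_finite.

(** This is the image under [T (x, _)] of [m] restricted to the section of [D] at [x]. The total
    mass may vary with [x]; [Doo] keeps it finite at each point, without a uniform bound. *)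
Lemma section_ftker : exists P : R.-ftker X ~> Y,
  forall x B, P x B = m (xsection (D `&` T @^-1` B) x).
Proof. by exists (section_kernel mD). Qed.

End kernel_of_sections.

(** * Cylinders and measurability in the Cantor space *)

(* Most recent bit first: a word extends another one by consing. *)
Fixpoint bits (s : nat -> bool) (n : nat) : seq bool :=
  if n is n'.+1 then s n' :: bits s n' else [::].

Lemma size_bits s n : size (bits s n) = n.
Proof. by elim: n => //= n ->. Qed.

Lemma eq_bits s t m n : (m <= n)%N -> bits s n = bits t n -> bits s m = bits t m.
Proof.
elim: n => [|n IH]; first by case: m.
rewrite leq_eqVlt => /orP[/eqP->//|mn /= [_]]; exact: IH.
Qed.

Definition cylinder (w : seq bool) : set (nat -> bool) :=
  [set s | bits s (size w) = w].

(** The empty set is included because cylinders of incompatible words are disjoint and a pi-system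
    is wanted. *)
Definition cylinders : set (set (nat -> bool)) :=
  [set A | A = set0 \/ exists w, A = cylinder w].

Lemma cylinder_nil : cylinder [::] = setT.
Proof. by apply/seteqP; split. Qed.

Lemma cylinder_cons b w :
  cylinder (b :: w) = cylinder w `&` [set s | s (size w) = b].
Proof.
apply/seteqP; split => s; rewrite /cylinder/=; first by case=> sb sw.
by move=> [-> ->].
Qed.

(** Two cylinders that meet are nested, the longer word giving the smaller one. *)
Lemma setI_closed_cylinders : setI_closed cylinders.
Proof.
move=> _ _ [->|[v ->]] [->|[w ->]]; rewrite ?set0I ?setI0; try by left.
wlog vw : v w / (size v <= size w)%N.
  by move=> h; case: (leqP (size v) (size w)) => [|/ltnW] /h //; rewrite setIC.
have [->|/set0P[s [sv sw]]] := eqVneq (cylinder v `&` cylinder w) set0.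
  by left.
right; exists w; apply/seteqP; split => [t []//|t tw]; split => //.
rewrite /cylinder/= -[RHS]sv; apply: (eq_bits vw).
by rewrite [LHS]tw [RHS]sw.
Qed.

Lemma bigcup_countType_measurable d (T : measurableType d) (I : countType)
    (P : set I) (F : I -> set T) :
  (forall i, P i -> measurable (F i)) -> measurable (\bigcup_(i in P) F i).
Proof.
move=> mF; rewrite bigcup_mkcond; apply: countable_bigcupT_measurable.
  exact: countableP.
by move=> i; case: ifP => // /set_mem; exact: mF.
Qed.

Notation cantor_space := (g_sigma_algebraType cylinders).

Lemma measurable_cylinder w : measurable (cylinder w : set cantor_space).
Proof. by apply: sub_sigma_algebra; right; exists w. Qed.

Lemma measurable_bit m : measurable [set s : cantor_space | s m].
Proof.
(* The head of a word of length [m.+1] is bit number [m]. *)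
have -> : [set s : cantor_space | s m] =
    \bigcup_(w in [set w : seq bool | size w = m.+1 /\ head false w]) cylinder w.
  apply/seteqP; split => [s /= sm|s [w [wm wh]]].
    exists (bits s m.+1); last by rewrite /cylinder/= size_bits.
    by rewrite /= size_bits.
  by rewrite /cylinder/= wm /= => sw; rewrite -sw in wh.
by apply: bigcup_countType_measurable => w _; exact: measurable_cylinder.
Qed.

Lemma measurable_fun_cantor d (T : measurableType d) (h : T -> cantor_space) :
  (forall w, measurable (h @^-1` cylinder w)) -> measurable_fun setT h.
Proof.
move=> mh; apply: (@measurability _ _ T cantor_space setT h cylinders) => //.
move=> _ [_ [->|[w ->]] <-]; rewrite setTI ?preimage_set0//; exact: mh.
Qed.

Lemma measurable_fun_cantor_bits d (T : measurableType d)
    (h : T -> cantor_space) :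
  (forall m, measurable [set t | h t m]) -> measurable_fun setT h.
Proof.
move=> mh; apply: measurable_fun_cantor; elim=> [|b w IH].
  by rewrite cylinder_nil preimage_setT.
rewrite cylinder_cons preimage_setI.
apply: measurableI => //; case: b; first exact: mh.
rewrite (_ : _ @^-1` _ = ~` [set t | h t (size w)]); first exact: measurableC.
by apply/seteqP; split => t /=; [move=> ->|move=> /negP/negbTE].
Qed.

(** * Measurable coding of a complete separable metric space *)

Section decoder.
Context (R : realType) (X : completePseudoMetricType R).
Hypothesis hX : hausdorff_space X.
Variable a : nat -> X.
Hypothesis da : forall x (e : R), (0 < e)%R -> exists n, ball x e (a n).

Let r (k : nat) : R := (k.+1%:R^-1)%R.

Let r_gt0 k : (0 < r k)%R.
Proof. by rewrite invr_gt0. Qed.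

Let r_small (e : R) : (0 < e)%R -> exists k, forall j, (k <= j)%N -> (r j < e)%R.
Proof.
move=> e0; near \oo => k; exists k => j kj.
apply: (@le_lt_trans _ _ (r k)); first by rewrite lef_pV2 ?posrE// ler_nat.
by near: k; exact: near_infty_natSinv_lt (PosNum e0).
Unshelve. all: by end_near. Qed.

(* Interiors, because balls of a pseudometric type need not be open. *)
Definition code (x : X) : cantor_space := fun m =>
  if unpickle m is Some (k, n) then `[< (ball (a n) (r k))^° x >] else false.

Lemma code_pickle x k n :
  code x (pickle (k, n)) = `[< (ball (a n) (r k))^° x >].
Proof. by rewrite /code pickleK. Qed.

(* The least [n] such that [s] puts the point in the ball of radius [r k] around
   [a n]; the junk value [0] only occurs outside the range of [code]. *)
Definition nearest (k : nat) (s : cantor_space) : nat :=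
  if pselect (exists n, s (pickle (k, n))) is left h then ex_minn h else 0%N.

Lemma nearest_code x k : ball (a (nearest k (code x))) (r k) x.
Proof.
rewrite /nearest; case: pselect => [h|[]].
  case: ex_minnP => n; rewrite code_pickle => /asboolP + _.
  exact: interior_subset.
(* With half the radius, a whole ball around [x] lies in [ball (a n) (r k)], so [x] is interior to
   the latter. *)
have r2 : (0 < r k / 2)%R by rewrite divr_gt0.
have [n xn] := da x r2; exists n; rewrite code_pickle; apply/asboolP.
rewrite /interior; apply: (filterS _ (nbhsx_ballx x _ r2)) => y xy.
by apply: (ball_split (z := x)) => //; exact: ball_sym.
Qed.

Lemma measurable_nearest k n : measurable [set s | nearest k s = n].
Proof.
pose P (i : nat) := [set s : cantor_space | s (pickle (k, i))].
have mP i : measurable (P i) by exact: measurable_bit.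
(* The second term accounts for the default value 0, taken when no bit of level [k] is set. *)
have -> : [set s | nearest k s = n] =
    (P n `&` \bigcap_(i in [set i | (i < n)%N]) ~` P i) `|`
    (if n == 0%N then \bigcap_i ~` P i else set0).
  apply/seteqP; split => s /=.
    rewrite /nearest; case: pselect => [h|h <-].
      case: ex_minnP => m sm mmin <-; left; split => // i /= im si.
      by move: (mmin _ si); rewrite leqNgt im.
    by right => i _ si; apply: h; exists i.
  rewrite /nearest; case: pselect => [h|h]; last first.
    by move=> [[sn _]|]; [case: h; exists n|case: eqP].
  case: ex_minnP => m sm mmin [[sn nmin]|].
    apply/eqP; rewrite eqn_leq mmin//= leqNgt; apply/negP => mn.
    exact: (nmin m mn).
  by case: eqP => // _ /(_ m Logic.I).
apply: measurableU.
  apply: measurableI => //; apply: bigcap_measurableType => i _.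
  exact: measurableC.
by case: ifP => // _; apply: bigcapT_measurable => i; exact: measurableC.
Qed.

Lemma measurable_nearest_pred (P : set nat) k : measurable [set s | P (nearest k s)].
Proof.
have -> : [set s | P (nearest k s)] = \bigcup_(n in P) [set s | nearest k s = n].
  apply/seteqP; split => s /=; first by exists (nearest k s).
  by case=> n Pn /= ->.
by apply: bigcup_measurable => n _; exact: measurable_nearest.
Qed.

Lemma measurable_nearest_rel (Q : nat -> nat -> Prop) k l :
  measurable [set s | Q (nearest k s) (nearest l s)].
Proof.
have -> : [set s | Q (nearest k s) (nearest l s)] =
    \bigcup_n ([set s | nearest k s = n] `&` [set s | Q n (nearest l s)]).
  apply/seteqP; split => s /=; first by exists (nearest k s).
  by case=> n _ /= [->].
apply: bigcupT_measurable => n; apply: measurableI; first exact: measurable_nearest.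
exact: (measurable_nearest_pred (Q n)).
Qed.

Definition approx (s : cantor_space) (k : nat) : X := a (nearest k s).

(** A Cauchy condition written with countable operations on comparisons of two values of [nearest],
    so that it is visibly measurable. By completeness it is equivalent to convergence of
    [approx s]. *)
Definition converges : set cantor_space :=
  \bigcap_j \bigcup_N \bigcap_(i in [set i | (N <= i)%N])
    [set s | ball (approx s N) (r j) (approx s i)].

Lemma measurable_converges : measurable converges.
Proof.
apply: bigcapT_measurable => j; apply: bigcupT_measurable => N.
apply: bigcap_measurableType => i _.
exact: (measurable_nearest_rel (fun n m => ball (a n) (r j) (a m))).
Qed.

Lemma converges_cvg s : converges s -> cvg (approx s @ \oo).
Proof.
move=> cs; apply: cauchy_cvg; apply: cauchy_exP => e e0.
have [k /(_ _ (leqnn k)) rke] := r_small e0.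
have [N _ sN] := cs k Logic.I; exists (approx s N).
by exists N => // i Ni; apply: (le_ball (ltW rke)); exact: sN.
Qed.

Lemma cvg_converges s (x : X) : approx s @ \oo --> x -> converges s.
Proof.
move=> sx j _; have r2 : (0 < r j / 2)%R by rewrite divr_gt0.
have [N _ sN] := sx _ (nbhsx_ballx x _ r2).
exists N => // i Ni /=; apply: (ball_split (z := x)); last exact: sN.
by apply: ball_sym; apply: sN => /=.
Qed.

Definition decode (s : cantor_space) : X :=
  if pselect (converges s) then lim (approx s @ \oo) else point.

(** The centre selected at level [k] is within [r k] of [x], so the centres tend to [x]; separation
    makes this limit unique. *)
Lemma codeK : cancel code decode.
Proof.
move=> x; have cx : approx (code x) @ \oo --> x.
  apply/cvg_ballP => e e0; have [k rke] := r_small e0.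
  exists k => // i /= ki; apply: (le_ball (ltW (rke _ ki))).
  by apply: ball_sym; exact: nearest_code.
rewrite /decode; case: pselect => [?|]; last by have := cvg_converges cx.
exact: (cvg_lim hX cx).
Qed.

(** A small ball around a late approximation stays in [U] when the limit is in [U], and conversely
    such a ball contains the limit. Only countable quantifiers over [nearest] remain, which gives
    measurability of [decode]. *)
Lemma decode_openE (U : set X) s : open U -> converges s ->
  U (decode s) <-> exists j N, forall i, (N <= i)%N ->
    ball (approx s i) (r j) `<=` U.
Proof.
move=> oU cs; rewrite /decode; case: pselect => // ? /=.
have sl : approx s @ \oo --> lim (approx s @ \oo) by exact: converges_cvg.
set l := lim _ in sl *; split.
  move=> Ul; have /nbhs_ballP[e /= e0 leU] : nbhs l U by exact: open_nbhs_nbhs.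
  have e2 : (0 < e / 2)%R by rewrite divr_gt0.
  have [j /(_ _ (leqnn j)) je] := r_small e2.
  have [N _ sN] := sl _ (nbhsx_ballx l _ e2).
  exists j, N => i Ni y iy; apply: leU; apply: (ball_split (z := approx s i)).
    exact: sN.
  exact: (le_ball (ltW je)).
move=> [j [N sU]]; have [M _ sM] := sl _ (nbhsx_ballx l _ (r_gt0 j)).
apply: (sU (maxn N M)); first exact: leq_maxl.
by apply: ball_sym; apply: sM => /=; exact: leq_maxr.
Qed.

Lemma measurable_decode (B : set X) :
  <<s [set U | open U] >> B -> measurable (decode @^-1` B).
Proof.
move=> mB; rewrite -[_ @^-1` _]setTI.
pose Y := g_sigma_algebraType [set U : set X | open U].
suff : measurable_fun setT (decode : cantor_space -> Y) by apply.
apply: (@measurability _ _ cantor_space Y setT decode [set U | open U]) => //.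
move=> _ [U oU <-]; rewrite setTI.
(* The last term collects the divergent sequences, all sent to [point]. *)
have -> : decode @^-1` U =
    (converges `&` \bigcup_j \bigcup_N \bigcap_(i in [set i | (N <= i)%N])
      [set s | ball (approx s i) (r j) `<=` U]) `|`
    (~` converges `&` [set _ | U point]).
  apply/seteqP; split => s /=.
    move=> Us; have [cs|ncs] := pselect (converges s).
      left; split=> //; have [+ _] := decode_openE oU cs.
      by move=> /(_ Us)[j [N h]]; exists j => //; exists N.
    by right; split => //; move: Us; rewrite /decode; case: pselect.
  case=> [[cs [j _ [N _ h]]]|[ncs]]; last by rewrite /decode; case: pselect.
  by apply/decode_openE => //; exists j, N.
apply: measurableU; apply: measurableI.
- exact: measurable_converges.
- apply: bigcupT_measurable => j; apply: bigcupT_measurable => N.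
  apply: bigcap_measurableType => i _.
  exact: (measurable_nearest_pred (fun n => ball (a n) (r j) `<=` U)).
- by apply: measurableC; exact: measurable_converges.
- have [Up|Up] := pselect (U point).
    by rewrite (_ : [set _ | _] = setT)//; apply/seteqP; split.
  by rewrite (_ : [set _ | _] = set0)//; apply/seteqP; split.
Qed.

Lemma measurable_code_bit m : <<s [set U | open U] >> [set x | code x m].
Proof.
rewrite /code; case: (unpickle m) => [[k n]|]; last first.
  suff -> : [set x : X | false] = set0 by exact: sigma_algebra0.
  by apply/seteqP; split.
apply: sub_sigma_algebra => /=.
suff -> : [set x | `[< (ball (a n) (r k))^° x >]] = (ball (a n) (r k))^°.
  exact: open_interior.
by apply/seteqP; split => x /asboolP.
Qed.

End decoder.

(** The coding of the Polish space is transported along the Borel isomorphism [f]. *)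
Lemma standard_borel_code (R : realType) d (T : measurableType d) :
  standard_borel R T ->
  exists (c : T -> cantor_space) (e : cantor_space -> T),
    [/\ measurable_fun setT c, measurable_fun setT e & cancel c e].
Proof.
move=> [X [f [hX [S cS dS] [g fK gK] mf]]].
have /countable_injP[idx idxI] := cS.
(* [idx] numbers the dense set injectively; integers that it misses get the default [point]. *)
pose a n : X := xget point [set x | S x /\ idx x = n].
have aS x : S x -> a (idx x) = x.
  move=> Sx; rewrite /a; apply: xget_unique; first by split.
  by move=> y [Sy xy]; apply: idxI => //; apply/mem_set.
have da x (e : R) : (0 < e)%R -> exists n, ball x e (a n).
  move=> e0; have [] := dS (ball x e)^°.
  - by exists x; exact: nbhsx_ballx.
  - exact: open_interior.
  - by move=> y [/interior_subset xy Sy]; exists (idx y); rewrite aS.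
have image_preimage_f (A : set X) : f @` (f @^-1` A) = A.
  apply/seteqP; split => [_ [t At <-]//|x Ax].
  by exists (g x); rewrite /= gK.
exists (code a \o f), (g \o decode a); split.
- apply: measurable_fun_cantor_bits => m; apply/mf.
  rewrite (_ : _ @` _ = [set x | code a x m]); first exact: measurable_code_bit.
  exact: image_preimage_f.
- move=> _ B mB; rewrite setTI.
  rewrite (_ : _ @^-1` B = decode a @^-1` (f @` B)).
    by apply: measurable_decode => //; exact/mf.
  apply/seteqP; split => s /=; first by exists (g (decode a s)).
  by move=> [t Bt ft]; rewrite -ft fK.
- by move=> t /=; rewrite codeK.
Qed.

(** * Partitions and densities for sigma-finite measures *)

Lemma sigma_finite_partition d (T : measurableType d) (R : realType)
    (m : {measure set T -> \bar R}) : sigma_finite setT m ->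
  exists E : (set T)^nat, [/\ forall n, measurable (E n),
    \bigcup_n E n = setT, trivIset setT E & forall n, m (E n) < +oo].
Proof.
move=> [F TF /all_and2[mF Foo]].
have mE n : measurable (seqDU F n).
  by apply: measurableD => //; exact: bigsetU_measurable.
exists (seqDU F); split => //; first by rewrite TF [RHS]seqDU_bigcup_eq.
move=> n; rewrite (le_lt_trans _ (Foo n))// le_measure ?inE//; exact: subDsetl.
Qed.

Lemma measure_partition d (T : measurableType d) (R : realType)
    (m : {measure set T -> \bar R}) (E : (set T)^nat) (A : set T) :
  (forall n, measurable (E n)) -> \bigcup_n E n = setT -> trivIset setT E ->
  measurable A -> m A = \sum_(n <oo) m (A `&` E n).
Proof.
move=> mE ET tE mA; rewrite -{1}(setIT A) -ET setI_bigcupr measure_bigcup//.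
- by apply: eq_eseriesl => n; rewrite in_setT.
- by move=> n _; exact: measurableI.
- exact: trivIset_setIl.
Qed.

Lemma integral_partition d (T : measurableType d) (R : realType)
    (m : {measure set T -> \bar R}) (E : (set T)^nat) (A : set T)
    (f : T -> \bar R) :
  (forall n, measurable (E n)) -> \bigcup_n E n = setT -> trivIset setT E ->
  measurable A -> measurable_fun setT f -> (forall x, 0 <= f x) ->
  \int[m]_(x in A) f x = \sum_(n <oo) \int[m]_(x in A `&` E n) f x.
Proof.
move=> mE ET tE mA mf f0; rewrite -{1}(setIT A) -ET setI_bigcupr.
rewrite ge0_integral_bigcup//.
- by move=> n; exact: measurableI.
- exact: measurable_funS mf.
- exact: trivIset_setIl.
Qed.

(** Radon-Nikodym is applied to the restriction of [m] to each piece of a partition into sets of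
    finite [m]-measure, and the densities are glued. The result is finite everywhere, not just
    almost everywhere. *)
Lemma sigma_finite_density d (T : measurableType d) (R : realType)
    (m : {measure set T -> \bar R})
    (nu : {sigma_finite_measure set T -> \bar R}) :
  sigma_finite setT m -> m `<< nu ->
  exists f : T -> R, [/\ measurable_fun setT f, forall x, (0 <= f x)%R &
    forall A, measurable A -> m A = \int[nu]_(x in A) (f x)%:E].
Proof.
move=> /sigma_finite_partition[E [mE ET tE Eoo]] mnu.
pose m_ n : {finite_measure set T -> \bar R} := mfrestr (mE n) (Eoo n).
have m_nu n : m_ n `<< nu.
  apply/null_content_dominatesP => A mA nuA0; rewrite /m_/= /mfrestr/= /mrestr.
  apply/eqP; rewrite eq_le measure_ge0 andbT.
  have /null_content_dominatesP/(_ A mA nuA0) <- := mnu.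
  by rewrite le_measure ?inE//; exact: measurableI.
have /choice[g gP] := fun n => radon_nikodym_sigma_finite (m_nu n).
(* [N x] is the index of the piece containing [x]. *)
have /choice[N EN] : forall x, exists n, E n x.
  by move=> x; have : setT x by []; rewrite -ET => -[n _]; exists n.
have NE n x : E n x -> N x = n.
  by move=> Enx; apply: tE => //; exists x.
pose f x := fine (g (N x) x).
have gfin n x : g n x \is a fin_num by have [] := gP n.
have g0 n x : 0 <= g n x by have [] := gP n.
have fE n x : E n x -> (f x)%:E = g n x.
  by move=> /NE; rewrite /f => ->; rewrite fineK.
have mf : measurable_fun setT f.
  rewrite -ET; apply/measurable_fun_bigcup => // n.
  apply: (@eq_measurable_fun _ _ _ _ _ (fine \o g n)).
    by move=> x /set_mem /NE; rewrite /f => ->.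
  apply: measurableT_comp => //; apply: measurable_funTS.
  by have [_ _ /integrableP[]] := gP n.
exists f; split => //; first by move=> x; rewrite fine_ge0.
move=> A mA; rewrite (measure_partition _ mE ET tE mA).
rewrite (integral_partition _ mE ET tE mA); last 2 first.
- exact/measurable_EFinP.
- by move=> x; rewrite lee_fin fine_ge0.
apply: eq_eseriesr => n _.
have [_ _ _ /(_ (A `&` E n) (measurableI _ _ mA (mE n)))] := gP n.
rewrite /m_/= /mfrestr/= /mrestr -setIA setIid => ->.
by apply: eq_integral => x /set_mem[_ Ex]; rewrite (fE n).
Qed.

(** * Random binary digits with prescribed cylinder masses *)

Section random_digits.
Context d (T : measurableType d) (R : realType) (f : seq bool -> T -> R).

(* [lower w x] is the left end of the subinterval of length [f w x] reserved for
   the word [w]; the child [false :: w] lies to the left of [true :: w]. *)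
Fixpoint lower (w : seq bool) (x : T) : R :=
  if w is b :: w' then (lower w' x + (if b then f (false :: w') x else 0))%R
  else 0%R.

Fixpoint word (x : T) (u : R) (n : nat) : seq bool :=
  if n is n'.+1 then
    let w := word x u n' in (lower w x + f (false :: w) x <= u)%R :: w
  else [::].

Definition digits (z : T * measurableTypeR R) : cantor_space := fun n =>
  let w := word z.1 z.2 n in (lower w z.1 + f (false :: w) z.1 <= z.2)%R.

Lemma bits_digits z n : bits (digits z) n = word z.1 z.2 n.
Proof. by elim: n => //= n ->. Qed.

Lemma measurable_digits : (forall w, measurable_fun setT (f w)) ->
  measurable_fun setT digits.
Proof.
move=> mf; have ml w : measurable_fun setT (lower w).
  elim: w => [|b w IH]; first exact: measurable_cst.
  by apply: measurable_funD => //; case: b.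
apply: measurable_fun_cantor; elim=> [|b w IH].
  by rewrite cylinder_nil preimage_setT.
(* Once the digits read so far are fixed to be [w], the next one is a single comparison of
   measurable functions. *)
have -> : digits @^-1` cylinder (b :: w) = digits @^-1` cylinder w `&`
    [set z | (lower w z.1 + f (false :: w) z.1 <= z.2)%R = b].
  rewrite cylinder_cons; apply/seteqP; split=> z [/[dup] zw];
  by rewrite /cylinder/= bits_digits /digits => ->.
apply: measurableI => //.
have : measurable_fun setT
    (fun z : T * measurableTypeR R => lower w z.1 + f (false :: w) z.1 <= z.2)%R.
  apply: measurable_fun_ler => //; apply: measurable_funD.
    exact: measurableT_comp.
  exact: measurableT_comp.
by move=> /(_ measurableT [set b] Logic.I); rewrite setTI.
Qed.

Variable x : T.
Hypothesis f0 : forall w, (0 <= f w x)%R.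
Hypothesis fD : forall w, f w x = (f (false :: w) x + f (true :: w) x)%R.

Lemma lower_cons b w : (lower w x <= lower (b :: w) x)%R /\
  (lower (b :: w) x + f (b :: w) x <= lower w x + f w x)%R.
Proof.
have := fD w; have := f0 (false :: w); have := f0 (true :: w).
by case: b => /= *; lra.
Qed.

Lemma lower_itv w : (0 <= lower w x)%R /\ (lower w x + f w x <= f [::] x)%R.
Proof.
elim: w => [|b w [IH1 IH2]]; first by rewrite /= add0r.
have [] := lower_cons b w; lra.
Qed.

(** The half-open intervals of the two children partition that of their parent, so at each level [u]
    selects exactly one word; words with [f w x = 0] have empty intervals and are never selected. *)
Lemma word_itv w u : (0 <= u < f [::] x)%R ->
  word x u (size w) = w <-> (lower w x <= u < lower w x + f w x)%R.
Proof.
move=> u01; elim: w => [|b w IH]; first by rewrite /= add0r.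
have fw := fD w; have f0w := f0 (false :: w); have f1w := f0 (true :: w).
rewrite [word _ _ _]/=; split=> [[+ wE]|uw].
  rewrite wE; move/IH : wE => wu.
  by case: b => /= [|/negbT]; rewrite -?ltNge => ?; lra.
have wE : word x u (size w) = w by apply/IH; case: b uw => /= uw; lra.
by rewrite wE; congr cons; case: b uw => /= uw; [|apply/negbTE; rewrite -ltNge]; lra.
Qed.

Lemma lebesgue_measure_digits w :
  lebesgue_measure ([set u | (0 <= u < f [::] x)%R] `&`
    [set u | cylinder w (digits (x, u))]) = (f w x)%:E.
Proof.
set A := _ `&` _; have -> : A = `[lower w x, (lower w x + f w x)%R[%classic.
  apply/seteqP; split=> u /=; rewrite in_itv/=.
    by move=> [u01]; rewrite /cylinder/= bits_digits => /(word_itv _ u01).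
  move=> uw; have [h1 h2] := lower_itv w.
  have u01 : (0 <= u < f [::] x)%R by lra.
  by split=> //; rewrite /cylinder/= bits_digits; apply/word_itv.
rewrite lebesgue_measure_itv/= lte_fin ltrDl -EFinD addrAC subrr add0r.
(* In the degenerate case the interval is empty and [f w x] is 0. *)
by case: ltP => // fw; congr EFin; apply/eqP; rewrite eq_le fw f0.
Qed.

End random_digits.

(** * Disintegration relative to a measure dominating the marginal *)

Lemma image_measure d1 d2 (X : measurableType d1) (Y : measurableType d2)
    (R : realType) (m : {measure set X -> \bar R}) (f : X -> Y) :
  measurable_fun setT f ->
  exists n : {measure set Y -> \bar R}, forall A, n A = m (f @^-1` A).
Proof. by move=> mf; unshelve refine (ex_intro _
  (pushforward m f : {measure set Y -> \bar R}) _). Qed.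

Section disintegration.
Context (R : realType) (d1 d2 : measure_display)
  (X1 : measurableType d1) (X2 : measurableType d2).
Hypothesis HX2 : standard_borel R X2.
Variables (rho : {measure set (X1 * X2)%type -> \bar R})
  (nu : {sigma_finite_measure set X1 -> \bar R}).

(** This is the first marginal of [rho] restricted to the strip above [B]. *)
Lemma slice_measure (B : set X2) : measurable B ->
  exists m : {measure set X1 -> \bar R}, forall A, m A = rho (A `*` B).
Proof.
move=> mB; have mTB : measurable ([set: X1] `*` B) by exact: measurableX.
have [m mE] := image_measure (mrestr rho mTB) (@measurable_fst _ _ X1 X2).
exists m => A; rewrite mE /mrestr; congr (rho _).
by apply/seteqP; split => -[x y] /=; tauto.
Qed.

Hypotheses (Hrho : sigma_finite setT (pushforward rho (fst : (X1 * X2)%type -> X1)))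
  (rho_nu : pushforward rho (fst : (X1 * X2)%type -> X1) `<< nu).

Let marginalE A : pushforward rho (fst : (X1 * X2)%type -> X1) A = rho (A `*` setT).
Proof. by congr (rho _); apply/seteqP; split => -[x y] /=; tauto. Qed.

(** Each slice is bounded by the full marginal, hence inherits its sigma-finiteness and its absolute
    continuity. *)
Lemma slice_density (B : set X2) : measurable B -> exists f : X1 -> R,
  [/\ measurable_fun setT f, forall x, (0 <= f x)%R &
   forall A, measurable A -> rho (A `*` B) = \int[nu]_(x in A) (f x)%:E].
Proof.
move=> mB; have [m mE] := slice_measure mB.
have m_le A : measurable A -> m A <= pushforward rho fst A.
  move=> mA; rewrite mE marginalE le_measure ?inE//; try exact: measurableX.
  by move=> [x y] [].
have [||f [mf f0 fE]] := @sigma_finite_density _ _ _ m nu.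
- have [F FT FP] := Hrho; exists F => // n; have [mF Foo] := FP n.
  by split => //; exact: le_lt_trans (m_le _ mF) Foo.
- apply/null_content_dominatesP => A mA nuA0.
  apply/eqP; rewrite eq_le measure_ge0 andbT.
  by have /null_content_dominatesP/(_ A mA nuA0) <- := rho_nu; exact: m_le.
by exists f; split => // A mA; rewrite -mE; exact: fE.
Qed.

Lemma disintegration : exists P : R.-ftker X1 ~> X2,
  forall (A : set X1) (B : set X2), measurable A -> measurable B ->
    rho (A `*` B) = \int[nu]_(x in A) P x B.
Proof.
have [c [e [mc me cK]]] := standard_borel_code HX2.
have mC w : measurable (c @^-1` cylinder w).
  by rewrite -[_ @^-1` _]setTI; apply: mc => //; exact: measurable_cylinder.
have [mu muE] := slice_measure (@measurableT _ X2).
(* The pieces [E n] serve twice: for integrability of the densities, and for the finite mass needed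
   in the uniqueness of measures. *)
have /sigma_finite_partition[E [mE ET tE Eoo]] : sigma_finite setT mu.
  have [F FT FP] := Hrho; exists F => // n; have [mF Foo] := FP n.
  by rewrite muE -marginalE.
have /choice[f fP] := fun w => slice_density (mC w).
have mf w : measurable_fun setT (f w) by have [] := fP w.
have f0 w x : (0 <= f w x)%R by have [] := fP w.
have fE w A : measurable A ->
    rho (A `*` c @^-1` cylinder w) = \int[nu]_(x in A) (f w x)%:E.
  by have [_ _] := fP w; exact.
have mEf w : measurable_fun setT (EFin \o f w) by exact/measurable_EFinP.
(* Additivity of [rho] gives both sides the same integral over every measurable set. Almost
   everywhere equality is deduced on each [E n], where [f w] is integrable. *)
have fD w : \forall x \ae nu,
    f w x = (f (false :: w) x + f (true :: w) x)%R.
  pose g x := (f (false :: w) x + f (true :: w) x)%R.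
  have mg : measurable_fun setT (EFin \o g).
    by apply/measurable_EFinP; exact: measurable_funD.
  have rhoD A : measurable A -> \int[nu]_(x in A) (f w x)%:E =
      \int[nu]_(x in A) (g x)%:E.
    move=> mA; under [RHS]eq_integral do rewrite EFinD.
    rewrite ge0_integralD//; try (by move=> x _; rewrite lee_fin);
      try exact: (measurable_funTS (mEf _)).
    rewrite -!fE// -measureU.
    - congr (rho _); rewrite !cylinder_cons; apply/seteqP; split => -[x y].
        by move=> [Ax cy]; case cyw : (c y (size w)); [right|left].
      by move=> [] [Ax []].
    - exact: measurableX.
    - exact: measurableX.
    - apply/seteqP; split => // -[x y] /=; rewrite !cylinder_cons.
      by move=> [[_ [_ /= ->]] [_ [_ /=]]].
  have fgE n : ae_eq nu (E n) (EFin \o f w) (EFin \o g).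
    apply: integral_ae_eq => //.
    - apply/integrableP; split; first exact: measurable_funTS.
      under eq_integral do rewrite /= ger0_norm//.
      rewrite -fE//; apply: le_lt_trans (Eoo n); rewrite muE.
      by apply: le_measure; rewrite ?inE; try exact: measurableX; move=> z [].
    - exact: measurable_funTS.
    - by move=> F _ mF; exact: rhoD.
  have := ae_foralln fgE; apply: filterS => x xE.
  have : setT x by []; rewrite -ET => -[n _ Enx].
  by have [] := xE n Enx.
(* Words are countable, so a single null set works for all of them. *)
have good : \forall x \ae nu, forall w,
    f w x = (f (false :: w) x + f (true :: w) x)%R.
  have := ae_foralln (fun n => fD (odflt [::] (unpickle n))).
  by apply: filterS => x h w; have := h (pickle w); rewrite pickleK.
pose D := [set z : X1 * measurableTypeR R | (0 <= z.2 < f [::] z.1)%R].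
have mD : measurable D.
  have : measurable_fun setT (fun z : X1 * measurableTypeR R => (0 <= z.2 < f [::] z.1)%R).
    apply: measurable_and; first exact: measurable_fun_ler.
    by apply: measurable_fun_ltr => //; exact: measurableT_comp.
  by move=> /(_ measurableT [set true] Logic.I); rewrite setTI.
have mT := measurable_digits mf.
have DE w x : (forall w, f w x = (f (false :: w) x + f (true :: w) x)%R) ->
    lebesgue_measure (xsection (D `&` digits f @^-1` cylinder w) x) = (f w x)%:E.
  move=> fx; rewrite -(lebesgue_measure_digits (f0 ^~ x) fx w).
  congr (lebesgue_measure _); apply/seteqP; split => u.
    by move=> /xsectionP.
  by move=> Du; apply/xsectionP.
(* This holds for every [x], even where the dyadic tree is inconsistent, so the kernel is finite
   everywhere. *)
have Doo x : lebesgue_measure (xsection D x) < +oo.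
  have -> : xsection D x = `[0%R, f [::] x[%classic.
    apply/seteqP; split => u; rewrite /= in_itv/=; first by move/xsectionP.
    by move=> Du; apply/xsectionP.
  by rewrite lebesgue_measure_itv/=; case: ifP; rewrite -?EFinD ltry.
have [P PE] := section_ftker (m := @lebesgue_measure R)
  (measurableT_comp me mT) mD Doo.
exists P => A B mA mB.
have mP : measurable_fun setT (P ^~ B) by exact: measurable_kernel.
(* Both sides are countably additive in [A], so [A] may be cut along the [E n]. *)
wlog muA : A mA / mu A < +oo.
  move=> fin; have [m mmE] := slice_measure mB.
  rewrite -mmE (measure_partition _ mE ET tE mA).
  rewrite (integral_partition _ mE ET tE mA)//.
  apply: eq_eseriesr => n _; rewrite mmE; apply: fin; first exact: measurableI.
  apply: le_lt_trans (Eoo n); apply: le_measure; rewrite ?inE//.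
  exact: measurableI.
have mAT : measurable (A `*` [set: X2]) by exact: measurableX.
have mAD : measurable (A `*` [set: measurableTypeR R] `&` D).
  by apply: measurableI => //; exact: measurableX.
have [m1 m1E] := image_measure (mrestr rho mAT) (measurableT_comp mc measurable_snd).
have [m2 m2E] := image_measure
  (mrestr (nu \x (@lebesgue_measure R)) mAD) mT.
have {}m1E S : m1 S = rho (A `*` c @^-1` S).
  by rewrite m1E /mrestr; congr (rho _); apply/seteqP; split => -[x y] /=; tauto.
have {}m2E S : m2 S = \int[nu]_(x in A)
    lebesgue_measure (xsection (D `&` digits f @^-1` S) x).
  rewrite m2E /mrestr /product_measure1 [RHS]integral_mkcond.
  apply: eq_integral => x _ /=; rewrite patchE; case: ifPn => [/set_mem Ax|/negP xA].
    congr (lebesgue_measure _); apply/seteqP; split => u /xsectionP.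
      by move=> [? [_ ?]]; exact/xsectionP.
    by move=> [? ?]; apply/xsectionP.
  rewrite (_ : xsection _ _ = set0) ?measure0//.
  apply/seteqP; split => u // /xsectionP[_ [[/= Ax _] _]].
  by apply: xA; exact/mem_set.
have m12 w : m1 (cylinder w) = m2 (cylinder w).
  rewrite m1E m2E fE//; apply: ge0_ae_eq_integral => //.
  - exact: measurable_funTS (mEf _).
  - apply: measurable_funTS; apply: (measurable_fun_xsection (@lebesgue_measure R)).
    apply: measurableI => //; rewrite -[_ @^-1` _]setTI; apply: mT => //.
    exact: measurable_cylinder.
  - by move=> x _; rewrite lee_fin.
  - by apply: filterS good => x xf _; rewrite DE.
rewrite (_ : rho _ = m1 (e @^-1` B)); last first.
  rewrite m1E; congr (rho (_ `*` _)); apply/seteqP; split => y /=; rewrite cK//.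
transitivity (m2 (e @^-1` B)); last first.
  by rewrite m2E; apply: eq_integral => x _; rewrite PE.
apply: (@measure_unique _ R cantor_space cylinders (fun=> setT)) => //.
- exact: setI_closed_cylinders.
- by move=> _; right; exists [::]; rewrite cylinder_nil.
- by rewrite bigcup_const.
- by move=> _ [->|[w ->]]; rewrite ?measure0.
- by move=> _; rewrite m1E preimage_setT -muE.
- by rewrite -[_ @^-1` _]setTI; exact: me.
Qed.

End disintegration.

(** * The equivalence with absolute continuity of the marginals *)

Lemma null_dominates_kernel (R : realType) (d1 d2 : measure_display)
    (X1 : measurableType d1) (X2 : measurableType d2)
    (m : set X1 -> \bar R) (nu : {measure set X1 -> \bar R})
    (P : R.-ftker X1 ~> X2) :
  (forall A, measurable A -> m A = \int[nu]_(x in A) P x setT) -> m `<< nu.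
Proof.
move=> mE; apply/null_content_dominatesP => A mA nuA0.
rewrite mE// null_set_integral//.
by apply: measurable_funTS; exact: measurable_kernel.
Qed.

(* The marginals of rho are measures on X1 and X2, sigma-finite like all
   measures considered here. This does not follow from the sigma-finiteness of
   rho, and it is necessary for F rho to be nonempty. *)
Theorem theorem5p15 (R : realType) (d1 d2 : measure_display)
    (X1 : measurableType d1) (X2 : measurableType d2)
    (HX1 : standard_borel R X1) (HX2 : standard_borel R X2)
    (rho : {sigma_finite_measure set (X1 * X2)%type -> \bar R})
    (Hrho1 : sigma_finite setT (pushforward rho (fst : (X1 * X2)%type -> X1)))
    (Hrho2 : sigma_finite setT (pushforward rho (snd : (X1 * X2)%type -> X2)))
    (nu1 : {sigma_finite_measure set X1 -> \bar R})
    (nu2 : {sigma_finite_measure set X2 -> \bar R}) :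
  F rho (nu1, nu2) <->
    pushforward rho (fst : (X1 * X2)%type -> X1) `<< nu1 /\
    pushforward rho (snd : (X1 * X2)%type -> X2) `<< nu2.
Proof.
split=> [[P [Q PQ]]|[rho_nu1 rho_nu2]].
  split.
    apply: (null_dominates_kernel (P := P)) => A mA.
    have [<- _] := PQ A setT mA measurableT.
    by congr (rho _); apply/seteqP; split => -[x y] /=; tauto.
  apply: (null_dominates_kernel (P := Q)) => B mB.
  have [_ <-] := PQ setT B measurableT mB.
  by congr (rho _); apply/seteqP; split => -[x y] /=; tauto.
have [P PE] := disintegration HX2 Hrho1 rho_nu1.
(* Swapping the factors turns the second marginal of [rho] into the first marginal of [rho'], so the
   same disintegration yields [Q]. *)
have [rho' rho'E] := image_measure rho (@measurable_swap _ _ X1 X2).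
have rho'1 : pushforward rho' fst =
    pushforward rho (snd : (X1 * X2)%type -> X2).
  by apply/funext => A; rewrite /pushforward rho'E.
rewrite -rho'1 in Hrho2 rho_nu2.
have [Q QE] := disintegration HX1 Hrho2 rho_nu2.
exists P, Q => A B mA mB; rewrite -PE// -QE// rho'E; split => //.
by congr (rho _); apply/seteqP; split => -[x y] [].
Qed.
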